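(* Let $\Lambda$ be a connected simple graph in which every vertex has valence at least $3$. Then the dart digraph $\mathrm{D}(\Lambda)$ and the squared dart digraph $\mathrm{A^2D}(\Lambda)$ are both strongly connected.
   Context: A digraph is a pair $(\mathcal{V},\mathcal{D})$ where $\mathcal{V}$ is a finite non-empty set of vertices and $\mathcal{D}$ is a set of ordered pairs of distinct vertices, called darts. A dart $(u,v)$ has initial vertex $u$ and terminal vertex $v$. A $2$-dart of a digraph is a pair $(x,y)$ of darts such that the terminal vertex of $x$ coincides with the initial vertex of $y$, while the initial vertex of $x$ does not coincide with the terminal vertex of $y$. A graph is a digraph in which, for every dart $(u,v)$, the reverse $(v,u)$ is also a dart; the pair $\{(u,v),(v,u)\}$ is then called an edge. (Thus all graphs are finite, non-empty and simple.) The valence of a vertex in a graph is its number of neighbours. Let $\Lambda$ be a graph with set of darts $\mathcal{D}$. The dart digraph $\mathrm{D}(\Lambda)$ is the digraph whose vertices are the darts of $\Lambda$ and whose darts are the $2$-darts of $\Lambda$. The squared dart digraph $\mathrm{A^2D}(\Lambda)$ is the digraph with vertex set $\mathcal{D}\times\mathcal{D}$ in which, for $x,y,z,w\in\mathcal{D}$, the pair $\bigl((x,y),(z,w)\bigr)$ is a dart if and only if $y=z$ and $(x,w)$ is a $2$-dart of $\Lambda$. A digraph is strongly connected if for any two vertices $u,v$ there is a directed path from $u$ to $v$ as well as one from $v$ to $u$. *)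

(* Defs.v *)
From mathcomp Require Import all_boot.

Set Implicit Arguments.
Unset Strict Implicit.
Unset Printing Implicit Defensive.

(* Digraphs are meant to be non-empty, but non-emptiness is not a field here:
   the dart digraph of an edgeless graph has no vertices.  It is a field of
   [graph] and a part of [strongly_connected] instead. *)
Record digraph := Digraph {
  vertex :> finType;
  adj : rel vertex;
  adj_irreflexive : irreflexive adj }.

Record graph := Graph {
  graph_digraph :> digraph;
  graph_nonempty : 0 < #|graph_digraph|;
  adj_symmetric : symmetric (@adj graph_digraph) }.

Definition dart (G : digraph) := {x : G * G | adj x.1 x.2}.

Definition initial (G : digraph) (x : dart G) : G := (val x).1.
Definition terminal (G : digraph) (x : dart G) : G := (val x).2.

Definition two_dart (G : digraph) : rel (dart G) := fun x y =>
  (terminal x == initial y) && (initial x != terminal y).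

Lemma two_dart_irreflexive (G : digraph) : irreflexive (@two_dart G).
Proof.
move=> [[u v] /= uv]; rewrite /two_dart /initial /terminal /=.
by case: eqP => // vu; rewrite vu adj_irreflexive in uv.
Qed.

Definition dart_digraph (L : graph) : digraph :=
  Digraph (@two_dart_irreflexive L).

Definition squared_dart_adj (L : graph) : rel (dart L * dart L) := fun p q =>
  (p.2 == q.1) && two_dart p.1 q.2.

Lemma squared_dart_adj_irreflexive (L : graph) :
  irreflexive (@squared_dart_adj L).
Proof.
move=> [x y]; rewrite /squared_dart_adj /=.
by case: eqP => // ->; rewrite two_dart_irreflexive.
Qed.

Definition squared_dart_digraph (L : graph) : digraph :=
  Digraph (@squared_dart_adj_irreflexive L).

Definition valence (L : graph) (v : L) : nat := #|[set w : L | adj v w]|.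

Definition connected (L : graph) : Prop :=
  forall u v : L, connect (@adj L) u v.

Definition strongly_connected (G : digraph) : Prop :=
  0 < #|G| /\
  forall u v : G, connect (@adj G) u v /\ connect (@adj G) v u.

(* Main.v *)
(* Write [x -> y] for two-darts.  At a vertex [v], the relation [->] from the
   darts into [v] to the darts out of [v] is a complete bipartite graph minus a
   perfect matching, so every [x -> y] is part of a permutation [f] of the darts
   with [z -> f z] for all [z].  Then [(a, b) |-> (b, f a)] permutes the vertices
   of the squared dart digraph along its darts, and going around its cycles shows
   that reachability is symmetric there.  Reachability being an equivalence, the
   class of [(x, y)] depends only on the initial vertices of [x] and [y] (any two
   darts out of a vertex have a common predecessor, by valence at least 3); call
   it [F a b].  The darts give [F a b = F b a'] for adjacent [a, a'], so walking
   from [a] to [b] gives [F a b = F b b = F b a], whence [F] is constant.  Finally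
   a path from [(x, x)] to [(z, z)] interleaves two dart walks starting at [x]. *)
Require Import Defs.
From mathcomp Require Import all_boot.

Set Implicit Arguments.
Unset Strict Implicit.
Unset Printing Implicit Defensive.

Lemma connect_sym_of_injective_selections (T : finType) (e : rel T) :
  (forall x y, e x y ->
     exists f : T -> T, [/\ injective f, f x = y & forall z, e z (f z)]) ->
  connect_sym e.
Proof.
move=> ef; suff sub x y : connect e x y -> connect e y x.
  by move=> x y; apply/idP/idP; apply: sub.
case/connectP=> p; elim: p x => [|z p IHp] x /= => [_ -> //|/andP[xz zp] y_def].
apply: connect_trans (IHp z zp y_def) _.
have [f [f_inj <- ef_f]] := ef _ _ xz.
(* An injective self-map of a finite type is a permutation, so iterating [f] from [f x] returns to
   [x]. *)
have: fconnect f (f x) x by rewrite fconnect_sym // fconnect1.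
by apply: connect_sub => u _ /eqP <-; apply: connect1.
Qed.

Lemma next_neq (T : eqType) (s : seq T) x :
  uniq s -> 1 < size s -> x \in s -> next s x != x.
Proof.
move=> s_uniq s_size /rot_to[i [|y t] def_s].
  by rewrite -(size_rot i) def_s in s_size.
have := s_uniq; rewrite -(next_rot i) // -(rot_uniq i) def_s /= inE eqxx.
by rewrite negb_or eq_sym => /andP[/andP[]].
Qed.

Section ValenceAtLeast3.

Variable L : graph.
Hypothesis L_valence : forall v : L, 3 <= valence v.

Lemma third_neighbour (v a b : L) : exists c, [&& adj v c, c != a & c != b].
Proof.
have: 0 < #|[set w : L | adj v w] :\: [set a; b]|.
  rewrite cardsD subn_gt0; apply: leq_ltn_trans (L_valence v).
  apply: leq_trans (subset_leq_card (subsetIr _ _)) _.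
  by rewrite cards2; case: (a != b).
by case/card_gt0P=> c; rewrite !inE negb_or -andbA => /and3P[ca cb vc];
  exists c; rewrite vc ca.
Qed.

Lemma exists_dart_from (v : L) : exists x : dart L, initial x == v.
Proof.
have [c /and3P[vc _ _]] := third_neighbour v v v.
by exists (exist _ (v, c) vc : dart L).
Qed.

Lemma common_predecessor (x y : dart L) :
  initial x = initial y -> exists z, two_dart z x && two_dart z y.
Proof.
move=> xy; have [c /and3P[vc cx cy]] :=
  third_neighbour (initial x) (terminal x) (terminal y).
have cv : adj c (initial x) by rewrite adj_symmetric.
exists (exist _ (c, initial x) cv : dart L).
by rewrite /two_dart {1 3}/terminal /= -xy eqxx /initial /= cx cy.
Qed.

Lemma two_dart_predecessor (x : dart L) : exists z, two_dart z x.
Proof. by have [z /andP[zx _]] := common_predecessor (erefl (initial x)); exists z. Qed.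

(* Each vertex [v] carries a cyclic order [l v] of its neighbours, and [(a, v)]
   is sent to [(v, next (l v) a)]; starting [l v] with [u; w] makes the
   two-dart [(u, v) -> (v, w)] part of the permutation. *)
Lemma two_dart_injective_selection (x y : dart L) : two_dart x y ->
  exists f : dart L -> dart L,
    [/\ injective f, f x = y & forall z, two_dart z (f z)].
Proof.
case: x y => [[u v] /= uv] [[v' w] /= vw].
rewrite /two_dart /initial /terminal /= => /andP[/eqP v'_def uw].
rewrite -{}v'_def in vw *.
pose N t := enum [set a : L | adj t a].
pose l t := if t == v then u :: w :: [seq a <- N t | a \notin [:: u; w]]
            else N t.
have l_mem t a : (a \in l t) = adj t a.
  rewrite /l; case: eqP => [->|_]; last by rewrite mem_enum inE.
  rewrite !inE mem_filter !inE mem_enum inE.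
  have vu : adj v u by rewrite adj_symmetric.
  by case: eqP => [->|_] //=; case: eqP => [->|].
have l_uniq t : uniq (l t).
  rewrite /l; case: eqP => _; last exact: enum_uniq.
  rewrite /= inE negb_or uw !mem_filter !inE !eqxx orbT /=.
  by apply/filter_uniq/enum_uniq.
have l_size t : 1 < size (l t).
  by rewrite /l; case: eqP => // _; rewrite -cardE; apply: ltnW (L_valence t).
have lP (z : dart L) : adj (terminal z) (next (l (terminal z)) (initial z)).
  by rewrite -l_mem mem_next l_mem adj_symmetric; apply: (valP z).
pose f z : dart L :=
  exist _ (terminal z, next (l (terminal z)) (initial z)) (lP z).
exists f; split.
(* The image determines which cyclic order was used, and on a duplicate-free list [prev] undoes
   [next]. *)
- move=> [[a b] ab] [[a' b'] ab'] /(congr1 val) /= [].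
  rewrite /terminal /initial /= => bb' aa'; apply: val_inj => /=.
  by move: aa'; rewrite bb' => /(can_inj (prev_next (l_uniq b'))) ->.
- apply: val_inj; rewrite /= /terminal /initial /=; congr (_, _).
  by rewrite /l eqxx /= eqxx.
- move=> z; rewrite /two_dart /initial /terminal /= eqxx /= eq_sym.
  by apply: next_neq; rewrite // l_mem adj_symmetric; apply: (valP z).
Qed.

Local Notation "p ~~> q" := (connect (@adj (squared_dart_digraph L)) p q)
  (at level 70).

Lemma squared_connect_sym : connect_sym (@adj (squared_dart_digraph L)).
Proof.
apply: connect_sym_of_injective_selections => -[x y] [y' w] /=.
rewrite /squared_dart_adj /= => /andP[/eqP <-] /two_dart_injective_selection.
case=> f [f_inj fx fP]; exists (fun p => (p.2, f p.1)); split.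
- by move=> [a b] [a' b'] /= [-> /f_inj ->].
- by rewrite /= fx.
- by move=> p; rewrite /= eqxx; apply: fP.
Qed.

Lemma squared_step (x y w : dart L) : two_dart x w -> (x, y) ~~> (y, w).
Proof. by move=> xw; apply: connect1; rewrite /= /squared_dart_adj /= eqxx. Qed.

Lemma squared_step_rev (x y w : dart L) : two_dart x w -> (y, w) ~~> (x, y).
Proof. by rewrite squared_connect_sym; apply: squared_step. Qed.

(** Go back to [(z, x)] for a common predecessor [z], then forward again. *)
Lemma squared_initial_r (x y y' : dart L) :
  initial y = initial y' -> (x, y) ~~> (x, y').
Proof.
case/common_predecessor=> z /andP[zy zy'].
exact: connect_trans (squared_step_rev x zy) (squared_step x zy').
Qed.

(** A step back turns the first component into the second, where it can be exchanged: [(x, y)],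
    [(p, x)], [(p, x')], [(x', y)]. *)
Lemma squared_initial (x x' y y' : dart L) :
  initial x = initial x' -> initial y = initial y' -> (x, y) ~~> (x', y').
Proof.
move=> xx' yy'; apply: connect_trans (squared_initial_r _ yy').
have [p py] := two_dart_predecessor y.
apply: connect_trans (squared_step_rev x py) _.
exact: connect_trans (squared_initial_r p xx') (squared_step x' py).
Qed.

Let out (v : L) : dart L := xchoose (exists_dart_from v).

Let initial_out v : initial (out v) = v.
Proof. exact/eqP/(xchooseP (exists_dart_from v)). Qed.

Local Notation F a b := (out a, out b).

Lemma squared_shift (a a' b : L) : adj a a' -> F a b ~~> F b a'.
Proof.
move=> aa'; pose x : dart L := exist _ (a, a') aa'.
(* Since [c] differs from [a], the dart [(a', c)] can follow [(a, a')]. *)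
have [c /and3P[a'c ca _]] := third_neighbour a' a a.
pose w : dart L := exist _ (a', c) a'c.
have xw : two_dart x w.
  by rewrite /two_dart /terminal /initial /= eqxx eq_sym.
apply: connect_trans (_ : (x, out b) ~~> _); first exact: squared_initial.
apply: connect_trans (squared_step _ xw) _.
by apply: squared_initial; rewrite // initial_out.
Qed.

(** A shift swaps the two coordinates, so each half of the induction step needs the other half of
    the hypothesis. *)
Lemma squared_diagonal (a b : L) :
  connect (@adj L) a b -> (F a b ~~> F b b) /\ (F b a ~~> F b b).
Proof.
case/connectP=> p; elim: p a => [|c p IHp] a /=; first by move=> _ ->.
case/andP=> ac cp b_def; have [cb bc] := IHp c cp b_def.
split; first exact: connect_trans (squared_shift b ac) bc.
rewrite squared_connect_sym in cb; rewrite squared_connect_sym.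
by apply: connect_trans cb _; apply: squared_shift; rewrite adj_symmetric.
Qed.

Hypothesis L_connected : connected L.

Lemma squared_connected (p q : dart L * dart L) : p ~~> q.
Proof.
have diagonal a b : F a b ~~> F b b.
  by case: (squared_diagonal (L_connected a b)).
(* Both sides are linked to [F a b], by a walk from [b] to [a] and by one from [a] to [b]. *)
have diagonal_eq a b : F a a ~~> F b b.
  apply: connect_trans (diagonal a b); rewrite squared_connect_sym.
  by case: (squared_diagonal (L_connected b a)).
have to_F (x y : dart L) : (x, y) ~~> F (initial x) (initial y).
  by apply: squared_initial; rewrite initial_out.
case: p q => [x y] [z w]; apply: connect_trans (to_F x y) _.
rewrite squared_connect_sym; apply: connect_trans (to_F z w) _.
apply: connect_trans (diagonal _ _) _; rewrite squared_connect_sym.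
exact: connect_trans (diagonal _ _) (diagonal_eq _ _).
Qed.

End ValenceAtLeast3.

(** Each step keeps one component and replaces the other by a successor of the old first one, so
    both stay reachable from [x]. *)
Lemma squared_connect_dart (L : graph) (x : dart L) (p q : dart L * dart L) :
  connect (@adj (squared_dart_digraph L)) p q ->
  connect (@two_dart L) x p.1 -> connect (@two_dart L) x p.2 ->
  connect (@two_dart L) x q.1.
Proof.
case/connectP=> s; elim: s p => [|r s IHs] p /= => [_ -> //|].
case/andP=> /andP[/eqP pr p_r] rs q_def xp1 xp2.
apply: IHs rs q_def _ _; first by rewrite -pr.
by apply: connect_trans xp1 _; apply: connect1.
Qed.

Theorem theorem2p4 (L : graph) (L_connected : connected L)
    (L_valence : forall v : L, 3 <= valence v) :
  strongly_connected (dart_digraph L) /\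
  strongly_connected (squared_dart_digraph L).
Proof.
have squared p q := squared_connected L_valence L_connected p q.
have [v _] := card_gt0P (graph_nonempty L).
have [x0 _] := exists_dart_from L_valence v.
have dart_connected x y : connect (@two_dart L) x y.
  exact: (squared_connect_dart (squared (x, x) (y, y))).
split; split=> //; first by apply/card_gt0P; exists x0.
by apply/card_gt0P; exists (x0, x0).
Qed.
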